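(* Let $G$ be a finite non-abelian group with centre $Z=Z(G)$ such that $G/Z\cong Z_p\times Z_p$, where $p$ is a prime. Put $n=\frac{(p-1)|Z|}{p}$. Then $$\text{CN-spec}(\Gamma(G))=\{(-(n-2))^{(p+1)(n-1)},\ ((n-1)(n-2))^{(p+1)}\}$$ and $$E_{CN}(\Gamma(G))=2(p+1)(n-1)(n-2).$$
   Context: $Z_p$ denotes the cyclic group of order $p$. For a finite non-abelian group $G$, the commuting conjugacy class graph $\Gamma(G)$ is the simple undirected graph whose vertices are the conjugacy classes of the non-central elements of $G$; two distinct vertices $a^G$ and $b^G$ are adjacent if there exist $a'\in a^G$, $b'\in b^G$ with $a'b'=b'a'$. For a finite simple graph $\mathcal{G}$ with vertices $v_1,\dots,v_N$, the common neighbourhood matrix $CN(\mathcal{G})$ is the $N\times N$ matrix whose $(i,j)$ entry is, for $i\ne j$, the number of vertices other than $v_i,v_j$ adjacent to both $v_i$ and $v_j$, and is $0$ for $i=j$. The CN-spectrum $\text{CN-spec}(\mathcal{G})$ is the multiset of eigenvalues of $CN(\mathcal{G})$; writing $\{\lambda_1^{\alpha_1},\dots,\lambda_k^{\alpha_k}\}$ means that $\lambda_i$ is listed $\alpha_i$ times (multiplicities of coinciding values add up; entries with exponent $0$ are absent). The CN-energy $E_{CN}(\mathcal{G})$ is the sum of the absolute values of the eigenvalues of $CN(\mathcal{G})$, counted with multiplicity. *)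

(* Defs.v *)
From HB Require Import structures.
From mathcomp Require Import all_boot all_order all_algebra all_fingroup.
From mathcomp Require Import all_solvable all_field.

Set Implicit Arguments.
Unset Strict Implicit.
Unset Printing Implicit Defensive.

Import Order.TTheory GRing.Theory Num.Theory.

Record sgraph := SGraph {
  vertex :> finType;
  adj : rel vertex;
  adj_sym : symmetric adj;
  adj_irr : irreflexive adj }.

Section Spectrum.
Local Open Scope ring_scope.

(* The eigenvalues with multiplicity, i.e. the roots of the characteristic
   polynomial; only determined up to permutation, so compare with perm_eq. *)
Definition spectrum n (A : 'M[algC]_n) : seq algC :=
  sval (closed_field_poly_normal (char_poly A)).

Lemma char_poly_spectrum n (A : 'M[algC]_n) :
  char_poly A = \prod_(z <- spectrum A) ('X - z%:P).
Proof.
rewrite /spectrum; case: closed_field_poly_normal => s /= {1}->.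
by rewrite (monicP (char_poly_monic A)) scale1r.
Qed.

Lemma mem_spectrum n (A : 'M[algC]_n) z : (z \in spectrum A) = eigenvalue A z.
Proof. by rewrite eigenvalue_root_char char_poly_spectrum root_prod_XsubC. Qed.

Definition CN (g : sgraph) : 'M[algC]_#|g| :=
  \matrix_(i, j)
    let v := enum_val i in let w := enum_val j in
    if i == j then 0
    else #|[set u : g | [&& u != v, u != w, adj v u & adj w u]]|%:R.

Definition CN_spec (g : sgraph) : seq algC := spectrum (CN g).

Definition CN_energy (g : sgraph) : algC := \sum_(z <- CN_spec g) `|z|.

End Spectrum.

Section CommutingConjugacyClassGraph.
Local Open Scope group_scope.
Variables (gT : finGroupType) (G : {group gT}).

Definition noncentral_classes : {set {set gT}} :=
  [set x ^: G | x in G :\: 'Z(G)].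

Definition ccc_vertex := {A : {set gT} | A \in noncentral_classes}.

Definition ccc_adj : rel ccc_vertex := fun A B =>
  (A != B) && [exists a in val A, exists b in val B, a * b == b * a].

Lemma ccc_adj_sym : symmetric ccc_adj.
Proof.
have sub A B : ccc_adj A B -> ccc_adj B A.
  case/andP=> nAB /exists_inP[a Aa /exists_inP[b Bb /eqP ab]].
  rewrite /ccc_adj eq_sym nAB; apply/exists_inP; exists b => //.
  by apply/exists_inP; exists a; rewrite ?ab.
by move=> A B; apply/idP/idP; apply: sub.
Qed.

Lemma ccc_adj_irr : irreflexive ccc_adj.
Proof. by move=> A; rewrite /ccc_adj eqxx. Qed.

Definition ccc_graph : sgraph := SGraph ccc_adj_sym ccc_adj_irr.

(* Hence the quotient (p - 1) |Z(G)| / p is a positive integer. *)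
Lemma dvdn_card_center p : prime p -> ~~ abelian G ->
  G / 'Z(G) \isog [set: 'Z_p * 'Z_p] -> p %| #|'Z(G)|.
Proof.
move=> p_pr nabG isoG; apply: contraR nabG => p'Z.
have oGZ : #|G / 'Z(G)| = (p ^ 2)%N.
  by rewrite (card_isog isoG) cardsT card_prod !card_ord Zp_cast ?prime_gt1.
have oG : #|G| = (#|'Z(G)| * p ^ 2)%N.
  by rewrite -oGZ card_quotient ?normal_norm ?center_normal // Lagrange ?center_sub.
have [P sylP] := Sylow_exists p G.
have oP : #|P| = (p ^ 2)%N.
  rewrite (card_Hall sylP) oG p_part lognM ?expn_gt0 ?cardG_gt0 ?prime_gt0 //.
  by rewrite pfactorK // lognE (negPf p'Z) andbF andbF.
have abP : abelian P.
  exact: card_p2group_abelian p_pr oP.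
have coZP : coprime #|'Z(G)| #|P|.
  by rewrite oP coprime_sym coprimeXl // prime_coprime.
have sPG := pHall_sub sylP.
have <- : 'Z(G) * P = G.
  apply/eqP; rewrite eqEcard mul_subG ?center_sub //=.
  by rewrite (coprime_cardMg coZP) oP oG.
rewrite abelianM center_abelian abP /=.
by rewrite (subset_trans sPG) // centsC subsetIr.
Qed.

End CommutingConjugacyClassGraph.

(* Main.v *)
Require Import Defs.
From mathcomp Require Import all_boot all_order all_algebra all_fingroup.
From mathcomp Require Import all_solvable all_field.
From mathcomp Require Import ring.

Import Order.TTheory GRing.Theory Num.Theory.
Local Open Scope ring_scope.

Set Implicit Arguments.
Unset Strict Implicit.

(** The graph is a disjoint union of [p + 1] cliques of size [n], and the
    spectrum of such a graph is read off from its incidence matrix.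

    Since the centre [Z] has index [p ^ 2], the centraliser of a non-central
    element lies strictly between [Z] and [G], so it has index [p] in [G] and
    contains [Z] with index [p] ([noncentral_index]).  Three things follow:
    the classes of non-central elements all have size [p]; these centralisers
    are abelian, being cyclic modulo a central subgroup, so that two
    non-central elements commute exactly when they have the same centraliser
    ([noncentral_cent1_eq]); and they are normal, because [G / Z] is abelian,
    so that the centraliser is constant along a class ([cent_class]).
    Adjacency is therefore equality of centralisers ([ccc_adjE]).  A clique
    consists of the classes inside some [C :\: Z] with [C] a centraliser of
    order [p * #|Z|], which makes [n = (p - 1) * #|Z| / p] of them; comparing
    with the count of all the classes in [G :\: Z] gives [p + 1] cliques.

    For the spectrum, let [U] be the incidence matrix of vertices against
    cliques.  Two vertices have [n - 2] common neighbours if they are in the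
    same clique and none otherwise, so the common neighbourhood matrix is
    [(n - 2) *: (U *m U^T - 1%:M)], whereas [U^T *m U] is the scalar [n].
    The identity relating the characteristic polynomials of [A *m B] and
    [B *m A] ([det_scalar_sub_mulmxC]) then reduces the first one to a scalar
    matrix ([char_poly_scaled_mulmx_sub1]). *)

(** * The common neighbourhood spectrum of a disjoint union of cliques *)

(** Both determinants come from the block matrix with rows [y, A] and [B, 1]:
    clearing [B] by column operations gives the left one, and by row
    operations, which scale the lower rows by [y], the right one. *)
Lemma det_scalar_sub_mulmxC (R : comNzRingType) m n (A : 'M[R]_(m, n))
    (B : 'M_(n, m)) y :
  y ^+ n * \det (y%:M - A *m B) = y ^+ m * \det (y%:M - B *m A).
Proof.
have d1 : \det (block_mx y%:M A B 1%:M) = \det (y%:M - A *m B).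
  have := det_mulmx (block_mx y%:M A B 1%:M) (block_mx 1%:M 0 (- B) 1%:M).
  rewrite mulmx_block det_lblock !det1 !mulr1 => <-.
  rewrite !mulmx1 !mulmx0 !mul1mx !add0r mulmxN subrr.
  by rewrite det_ublock det1 mulr1.
have := det_mulmx (block_mx 1%:M 0 (- B) y%:M) (block_mx y%:M A B 1%:M).
rewrite mulmx_block det_lblock det1 mul1r det_scalar d1 => <-.
rewrite !mul1mx !mul0mx !addr0 mulmx1 mulNmx mul_mx_scalar mul_scalar_mx.
by rewrite addNr det_ublock det_scalar mulNmx addrC.
Qed.

(** With [y = 'X + c], the characteristic matrix is [y - (c *: U) *m V], and
    exchanging the factors leaves the scalar matrix [y - c * m] of size [k].
    The hypothesis [0 < m] rules out the empty matrix with [k > 0], where the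
    truncated subtraction would make the formula fail. *)
Lemma char_poly_scaled_mulmx_sub1 (F : fieldType) N k m (U : 'M[F]_(N, k))
    (V : 'M_(k, N)) c :
    (0 < m)%N -> N = (k * m)%N -> V *m U = m%:R%:M ->
  char_poly (c *: (U *m V - 1%:M)) =
    ('X - (- c)%:P) ^+ (k * (m - 1)) * ('X - (c * (m%:R - 1))%:P) ^+ k.
Proof.
move=> m_gt0 dimN VU.
pose y : {poly F} := 'X - (- c)%:P.
have y_n0 : y != 0 by rewrite polyXsubC_eq0.
have yN : y ^+ N = y ^+ k * y ^+ (k * (m - 1)).
  by rewrite -exprD -mulnS subn1 prednK // -dimN.
pose UP := c%:P *: map_mx polyC U; pose VP := map_mx polyC V.
have := det_scalar_sub_mulmxC UP VP y.
have -> : y%:M - UP *m VP = char_poly_mx (c *: (U *m V - 1%:M)).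
  rewrite /char_poly_mx /UP /VP -scalemxAl -map_mxM map_mxZ map_mxB map_mx1.
  rewrite scalerBr opprB scale_scalar_mx mulr1 addrA -raddfD /=.
  by rewrite /y polyCN opprK.
have -> : y%:M - VP *m UP = ('X - (c * (m%:R - 1))%:P)%:M.
  rewrite /UP /VP -scalemxAr -map_mxM VU map_scalar_mx scale_scalar_mx.
  rewrite -raddfB /=; congr (_%:M).
  by rewrite /y polyCN opprK -polyCM mulrBr mulr1 polyCB opprB addrA.
rewrite det_scalar yN -mulrA; apply: mulfI.
by rewrite expf_neq0.
Qed.

Section DisjointCliques.

(* The labelling [f] names the clique of a vertex.  It need not be
   onto, so the cliques are counted by its image. *)
Variables (g : sgraph) (T : finType) (f : g -> T) (m : nat).
Hypothesis adjE : forall u v : g, adj u v = (u != v) && (f u == f v).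
Hypothesis card_fiber : forall v : g, #|[set u | f u == f v]| = m.

Let k := #|[set f v | v : g]|.

Lemma card_cliques : #|g| = (k * m)%N.
Proof.
rewrite -sum1_card (partition_big_imset f) /= -sum_nat_const /k.
apply: eq_bigr => _ /imsetP[v _ ->].
by rewrite -(card_fiber v) -sum1_card; apply: eq_bigl => u; rewrite inE.
Qed.

Lemma common_neighbours v w : v != w ->
  #|[set u : g | [&& u != v, u != w, adj v u & adj w u]]|
    = (if f v == f w then m - 2 else 0)%N.
Proof.
move=> vw; case: eqP => [fvw|/eqP nfvw]; last first.
  apply: eq_card0 => u; rewrite !inE !adjE; apply/negP.
  case/and4P=> _ _ /andP[_ /eqP fvu] /andP[_ /eqP fwu].
  by rewrite fvu fwu eqxx in nfvw.
rewrite -(card_fiber w) (cardsD1 v [set u | f u == f w]).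
rewrite (cardsD1 w (_ :\ v)) !inE fvw !eqxx (eq_sym w) vw.
rewrite !add1n subn2 /=; apply: eq_card => u; rewrite !inE !adjE fvw.
rewrite (eq_sym v) (eq_sym w) (eq_sym (f w)).
by case: (u == v); case: (u == w); case: (f u == f w).
Qed.

(* The incidence matrix of vertices against cliques. *)
Let U : 'M[algC]_(#|g|, k) :=
  \matrix_(i, j) (f (enum_val i) == enum_val j)%:R.

Lemma mem_clique v : f v \in [set f v | v : g].
Proof. exact: imset_f. Qed.

Lemma incidence_mulmxE i j :
  (U *m U^T) i j = (f (enum_val i) == f (enum_val j))%:R.
Proof.
rewrite mxE; pose l := enum_rank_in (mem_clique (enum_val i)) (f (enum_val i)).
have El : enum_val l = f (enum_val i) by rewrite enum_rankK_in ?mem_clique.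
rewrite (bigD1 l) //= big1 ?addr0 => [|l' ne_l].
  by rewrite !mxE El eqxx mul1r eq_sym.
by rewrite !mxE -El (inj_eq enum_val_inj) eq_sym (negPf ne_l) mul0r.
Qed.

Lemma incidence_gram : U^T *m U = m%:R%:M.
Proof.
apply/matrixP=> l l'; rewrite !mxE.
pose F u : nat := (f u == enum_val l) && (f u == enum_val l').
transitivity ((\sum_(i < #|g|) F (enum_val i))%:R : algC).
  by rewrite natr_sum; apply: eq_bigr => i _; rewrite !mxE -natrM mulnb.
rewrite -(big_enum_val (A := g)) -mulrnA; congr (_%:R).
have [ll'|ne_l] := eqVneq l l'; last first.
  rewrite muln0 big1 // => u _; apply/eqP; rewrite eqb0.
  apply/negP=> /andP[/eqP ->].
  by rewrite (inj_eq enum_val_inj) (negPf ne_l).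
have /imsetP[v _ Ev] := enum_valP l.
rewrite muln1 -(card_fiber v) -sum1dep_card [RHS]big_mkcond /=.
by apply: eq_bigr => u _; rewrite /F -ll' andbb Ev; case: eqP.
Qed.

Lemma CN_cliques : CN g = (m%:R - 2) *: (U *m U^T - 1%:M).
Proof.
apply/matrixP=> i j; rewrite 3!mxE incidence_mulmxE mxE [in RHS]mxE.
have [-> | ne_ij] /= := eqVneq i j; first by rewrite eqxx subrr mulr0.
have vw : enum_val i != enum_val j by rewrite (inj_eq enum_val_inj).
rewrite common_neighbours // subr0; case: ifP => fvw; last by rewrite mulr0.
rewrite mulr1 natrB // -(card_fiber (enum_val i)).
rewrite (cardsD1 (enum_val i)) (cardsD1 (enum_val j)) !inE (eqP fvw) eqxx.
by rewrite eq_sym vw.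
Qed.

Lemma CN_spec_cliques : (0 < m)%N ->
  perm_eq (CN_spec g)
    (nseq (k * (m - 1)) (- (m%:R - 2)) ++ nseq k ((m%:R - 1) * (m%:R - 2))).
Proof.
move=> m_gt0; apply: prod_XsubC_eq.
rewrite -char_poly_spectrum CN_cliques.
rewrite (char_poly_scaled_mulmx_sub1 _ m_gt0 card_cliques incidence_gram).
by rewrite big_cat !big_nseq !iter_mulr_1 /= [_ * (m%:R - 1)]mulrC.
Qed.

(** Positive and negative eigenvalues contribute equally, the trace being zero.
    If [m = 1] the eigenvalue [- (m - 2)] is [1], but its multiplicity is zero. *)
Lemma CN_energy_cliques : (0 < m)%N ->
  CN_energy g = 2 * k%:R * (m%:R - 1) * (m%:R - 2).
Proof.
move=> m_gt0; rewrite /CN_energy (perm_big _ (CN_spec_cliques m_gt0)) /=.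
have sum_nseq l (x : algC) : \sum_(z <- nseq l x) `|z| = l%:R * `|x|.
  by rewrite big_nseq iter_addr_0 mulr_natl.
rewrite big_cat /= !sum_nseq normrN natrM natrB //.
have [m_gt1 | m_le1] := ltnP 1 m.
  have m2 : 0 <= m%:R - 2 :> algC by rewrite subr_ge0 ler_nat.
  have m1 : 0 <= m%:R - 1 :> algC by rewrite subr_ge0 ler1n ltnW.
  by rewrite ger0_norm // ger0_norm ?mulr_ge0 //; ring.
have -> : m = 1%N by apply/eqP; rewrite eqn_leq m_le1.
by rewrite subrr !(mul0r, mulr0) normr0 mulr0 addr0.
Qed.

End DisjointCliques.

(** * Centralisers when the centre has index the square of a prime *)

Section CentreOfIndexPrimeSquare.

Local Open Scope group_scope.

Variables (gT : finGroupType) (G : {group gT}) (p : nat).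
Hypothesis p_pr : prime p.
Hypothesis indexZ : #|G : 'Z(G)| = (p ^ 2)%N.

Let Z := 'Z(G).

Lemma center_sub_cent1 x : x \in G -> Z \subset 'C_G[x].
Proof.
move=> Gx; rewrite subsetI center_sub sub_cent1.
by rewrite (subsetP _ _ Gx) // centsC subsetIr.
Qed.

(** The two indices multiply to [p ^ 2] and neither is [1]: a centraliser equal
    to [G] would make [x] central, and so would one equal to [Z], since it
    contains [x]. *)
Lemma noncentral_index x : x \in G :\: Z ->
  #|G : 'C_G[x]| = p /\ #|'C_G[x] : Z| = p.
Proof.
case/setDP=> Gx nZx.
have sCG : 'C_G[x] \subset G := subsetIl _ _.
have sZC := center_sub_cent1 Gx.
have := Lagrange_index sCG sZC; rewrite indexZ => def_pp.
have ne_G : #|G : 'C_G[x]| != 1%N.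
  apply: contra nZx => /eqP/(index1g sCG) defG.
  by rewrite inE Gx -sub_cent1 -defG subsetIr.
have ne_Z : #|'C_G[x] : Z| != 1%N.
  apply: contra nZx => /eqP/(index1g sZC) defZ.
  by rewrite /Z defZ inE Gx cent1id.
have /(dvdn_pfactor _ _ p_pr)[e le_e2 def_e]: (#|G : 'C_G[x]| %| p ^ 2)%N.
  by rewrite -def_pp dvdn_mulr.
have p_gt0 := prime_gt0 p_pr.
case: e le_e2 def_e => [|[|[|//]]] _ def_e; first by rewrite def_e in ne_G.
  split; first by rewrite def_e expn1.
  by apply/eqP; rewrite -(eqn_pmul2l p_gt0) mulnn -def_pp def_e expn1.
case/eqP: ne_Z; apply/eqP.
rewrite -(@eqn_pmul2l (p ^ 2)) ?expn_gt0 ?p_gt0 // muln1.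
by rewrite -[in X in _ == X]def_pp def_e.
Qed.

Lemma card_noncentral_class x : x \in G :\: Z -> #|x ^: G| = p.
Proof. by move=> /noncentral_index[<- _]; rewrite index_cent1. Qed.

(** The quotient by the central subgroup [Z] has prime order, hence is cyclic. *)
Lemma noncentral_cent1_abelian x : x \in G :\: Z -> abelian 'C_G[x].
Proof.
move=> Zx; have [_ indexC] := noncentral_index Zx.
have /setDP[Gx _] := Zx; have sZC := center_sub_cent1 Gx.
have cZC : Z \subset 'Z('C_G[x]).
  rewrite subsetI sZC (subset_trans (subsetIr _ _)) //.
  by rewrite centS ?subsetIl.
have nZC : 'C_G[x] \subset 'N(Z).
  by rewrite (subset_trans (subsetIl _ _)) ?normal_norm ?center_normal.
by rewrite (cyclic_factor_abelian cZC) // prime_cyclic // card_quotient ?indexC.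
Qed.

(** [G / Z] has order [p ^ 2], so it is abelian and [Z] contains the derived
    subgroup; every subgroup above [Z] is then normal. *)
Lemma cent1_normal x : x \in G -> 'C_G[x] <| G.
Proof.
move=> Gx; apply: sub_der1_normal (subsetIl _ _).
apply: subset_trans (center_sub_cent1 Gx).
have nZG : G \subset 'N(Z) by rewrite normal_norm ?center_normal.
rewrite der1_min // (card_p2group_abelian p_pr) //.
by rewrite card_quotient.
Qed.

(** Inclusion both ways: an abelian centraliser lies in the centraliser of each
    of its elements, and commuting is symmetric. *)
Lemma noncentral_cent1_eq x y : x \in G :\: Z -> y \in G :\: Z ->
  y \in 'C_G[x] -> 'C_G[y] = 'C_G[x].
Proof.
have sub u v : u \in G :\: Z -> v \in 'C_G[u] -> 'C_G[u] \subset 'C_G[v].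
  move=> Zu Cv; rewrite subsetI subsetIl sub_cent1.
  by apply: subsetP Cv; apply: noncentral_cent1_abelian.
move=> Zx Zy Cy; apply/eqP; rewrite eqEsubset !sub //.
by rewrite inE cent1C; case/setDP: Zx => -> _; case/setIP: Cy.
Qed.

Lemma noncentral_class x : x \in G :\: Z -> x ^: G \subset 'C_G[x] :\: Z.
Proof.
move=> /setDP[Gx nZx]; rewrite class_sub_norm.
  by rewrite inE nZx inE Gx cent1id.
by rewrite normsD ?normal_norm ?center_normal ?cent1_normal.
Qed.

(** The whole class of [x] lies in the abelian group ['C_G[x]], so commuting with
    [x] and commuting with all its conjugates are the same.  This allows a class
    to be labelled by its centraliser without choosing a representative. *)
Lemma cent_class x : x \in G :\: Z -> 'C_G(x ^: G) = 'C_G[x].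
Proof.
move=> Zx; apply/eqP; rewrite eqEsubset setIS /=; last first.
  by apply/subsetP=> y /centP cAy; apply/cent1P/cAy; apply: class_refl.
rewrite subsetI subsetIl (sub_abelian_cent (noncentral_cent1_abelian Zx)) //.
exact: subset_trans (noncentral_class Zx) (subsetDl _ _).
Qed.

(** * The cliques of the commuting conjugacy class graph *)

(** The classes are the orbits of conjugation on [D] and have size [p].  This
    count serves twice: for one clique, and for the whole graph. *)
Lemma card_noncentral_classes (D : {set gT}) :
    D \subset G :\: Z -> G \subset 'N(D) ->
  (#|[set x ^: G | x in D]| * p)%N = #|D|.
Proof.
move=> sD nDG; symmetry; apply: card_uniform_partition => [_ /imsetP[x Dx ->]|].
  by rewrite card_noncentral_class ?(subsetP sD).
have -> : [set x ^: G | x in D] = [set orbit 'J G x | x in D].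
  by apply: eq_imset => x; rewrite orbitJ.
apply: orbit_partition.
by rewrite astabsJ.
Qed.

Lemma noncentral_classP (A : ccc_graph G) x :
  x \in val A -> x \in G :\: Z /\ val A = x ^: G.
Proof.
have /imsetP[y Zy ->] := valP A => /class_eqP eq_xy; split=> //.
have nGZ : G \subset 'N(G :\: Z).
  by rewrite normsD ?normG ?normal_norm ?center_normal.
by rewrite (subsetP (_ : y ^: G \subset _)) ?class_sub_norm // -eq_xy class_refl.
Qed.

Let cl (A : ccc_graph G) := 'C_G(val A).

(** Commuting elements of two classes are non-central, hence have the same
    centraliser; conversely, if the centralisers coincide, any two elements of
    the classes commute. *)
Lemma ccc_adjE (A B : ccc_graph G) : adj A B = (A != B) && (cl A == cl B).
Proof.
rewrite /= /ccc_adj; congr (_ && _).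
apply/exists_inP/eqP => [[a Aa /exists_inP[b Bb /eqP ab]] | eqC].
  have [Za defA] := noncentral_classP Aa.
  have [Zb defB] := noncentral_classP Bb.
  rewrite /cl defA defB !cent_class //; symmetry; apply: noncentral_cent1_eq => //.
  by rewrite inE; case/setDP: Zb => -> _; apply/cent1P.
have /imsetP[a Za defA] := valP A; have /imsetP[b Zb defB] := valP B.
have [Aa Bb]: a \in val A /\ b \in val B by rewrite defA defB !class_refl.
exists a => //; apply/exists_inP; exists b => //.
move: eqC; rewrite /cl defA defB !cent_class // => eqC.
have: a \in 'C_G[b] by rewrite -eqC inE cent1id andbT; case/setDP: Za.
by case/setIP=> _ /cent1P->.
Qed.

(** The classes labelled by [C = 'C_G[a]] are those contained in [C :\: Z], a set
    of [p * #|Z| - #|Z|] elements. *)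
Lemma card_ccc_clique_mul (A : ccc_graph G) :
  (#|[set B : ccc_graph G | cl B == cl A]| * p)%N = ((p - 1) * #|Z|)%N.
Proof.
have /imsetP[a Za defA] := valP A; have /setDP[Ga nZa] := Za.
have p_gt0 := prime_gt0 p_pr; pose D := 'C_G[a] :\: Z.
have sDZ : D \subset G :\: Z by rewrite setSD ?subsetIl.
have nDG : G \subset 'N(D).
  by rewrite normsD ?normal_norm ?center_normal ?cent1_normal.
have cardD : #|D| = ((p - 1) * #|Z|)%N.
  rewrite cardsD (setIidPr (center_sub_cent1 Ga)).
  rewrite -(Lagrange (center_sub_cent1 Ga)) mulnBl mul1n mulnC.
  by have [_ ->] := noncentral_index Za.
rewrite -cardD -(card_noncentral_classes sDZ nDG); congr (_ * _)%N.
rewrite -(card_imset _ val_inj); congr #|pred_of_set _|.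
apply/setP=> X; apply/imsetP/imsetP => [[B] | [x Dx ->]].
  rewrite inE /cl defA => /eqP; have /imsetP[b Zb defB] := valP B.
  rewrite defB !cent_class // => eqC ->; exists b; rewrite // inE -eqC.
  by case/setDP: Zb => Gb ->; rewrite inE Gb cent1id.
have Zx := subsetP sDZ x Dx.
have Vx : x ^: G \in noncentral_classes G by apply: imset_f.
exists (Sub (x ^: G) Vx); rewrite ?SubK // inE /cl SubK defA !cent_class //.
by rewrite (noncentral_cent1_eq Za) //; case/setDP: Dx.
Qed.

Lemma card_ccc_clique (A : ccc_graph G) :
  #|[set B : ccc_graph G | cl B == cl A]| = ((p - 1) * #|Z| %/ p)%N.
Proof. by rewrite -(card_ccc_clique_mul A) mulnK ?prime_gt0. Qed.

Lemma card_ccc_graph : (#|ccc_graph G| * p)%N = ((p ^ 2 - 1) * #|Z|)%N.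
Proof.
have -> : #|ccc_graph G| = #|noncentral_classes G|.
  by rewrite card_sig; apply: eq_card.
rewrite card_noncentral_classes //.
  rewrite cardsD (setIidPr (center_sub _)) -(Lagrange (center_sub G)) indexZ.
  by rewrite mulnBl mul1n mulnC.
by rewrite normsD ?normG ?normal_norm ?center_normal.
Qed.

Lemma ccc_vertex_exists : exists A : ccc_graph G, true.
Proof.
suff /card_gt0P[A _]: (0 < #|ccc_graph G|)%N by exists A.
rewrite -(ltn_pmul2r (prime_gt0 p_pr)) card_ccc_graph mul0n.
by rewrite muln_gt0 cardG_gt0 subn_gt0 -{1}(exp1n 2) ltn_exp2r ?prime_gt1.
Qed.

Lemma ccc_clique_gt0 : (0 < (p - 1) * #|Z| %/ p)%N.
Proof.
have [A _] := ccc_vertex_exists; rewrite -(card_ccc_clique A).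
by apply/card_gt0P; exists A; rewrite inE.
Qed.

(** Counting non-central elements in two ways: there are [(p ^ 2 - 1) * #|Z|] of
    them in all, and [(p - 1) * #|Z|] in each clique. *)
Lemma card_ccc_cliques : #|[set cl A | A : ccc_graph G]| = (p + 1)%N.
Proof.
have [A _] := ccc_vertex_exists; have := card_ccc_graph.
rewrite (card_cliques card_ccc_clique) -mulnA -(card_ccc_clique A).
have -> : (p ^ 2 - 1 = (p + 1) * (p - 1))%N.
  by rewrite mulnC -subn_sqr exp1n.
rewrite card_ccc_clique_mul -mulnA => /eqP.
by rewrite eqn_pmul2r ?muln_gt0 ?subn_gt0 ?prime_gt1 ?cardG_gt0 // => /eqP.
Qed.

End CentreOfIndexPrimeSquare.

Theorem theorem2p9 (gT : finGroupType) (G : {group gT}) (p : nat)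
    (nonabG : ~~ abelian G) (p_pr : prime p)
    (isoGZ : (G / 'Z(G) \isog [set: 'Z_p * 'Z_p])%g) :
  let n := ((p - 1) * #|'Z(G)%g| %/ p)%N in
  perm_eq (CN_spec (ccc_graph G))
          (nseq ((p + 1) * (n - 1))%N (- (n%:R - 2))
           ++ nseq (p + 1)%N ((n%:R - 1) * (n%:R - 2)))
  /\ CN_energy (ccc_graph G) = 2 * (p%:R + 1) * (n%:R - 1) * (n%:R - 2).
Proof.
have indexZ : #|G : 'Z(G)|%g = (p ^ 2)%N.
  rewrite -card_quotient ?normal_norm ?center_normal // (card_isog isoGZ).
  by rewrite cardsT card_prod !card_ord Zp_cast ?prime_gt1.
move=> n; have n_gt0 : (0 < n)%N := ccc_clique_gt0 p_pr indexZ.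
have adjE := ccc_adjE p_pr indexZ; have cardC := card_ccc_clique p_pr indexZ.
rewrite natr1 -(addn1 p) -(card_ccc_cliques p_pr indexZ).
split; [exact: CN_spec_cliques | exact: CN_energy_cliques].
Qed.
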